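(* Let $G$ be a minimally transitive permutation group on a finite set $\Omega$. If $G$ is quasi-primitive on $\Omega$, then $G$ is simple. Otherwise, if $H$ is a proper normal subgroup of $G$, then $G$ acts minimally transitively on the set of $H$-orbits on $\Omega$.
   Context: A transitive permutation group $G\subseteq \mathrm{Sym}(\Omega)$ on a finite set $\Omega$ is minimally transitive if every proper subgroup of $G$ is intransitive on $\Omega$. More generally, a (not necessarily faithful) transitive action of a finite group $G$ on a finite set $\Omega^*$ with kernel $K$ is minimally transitive if every proper subgroup $H$ of $G$ with $K\subseteq H$ acts intransitively on $\Omega^*$; equivalently, the permutation group induced by $G/K$ on $\Omega^*$ is minimally transitive. A transitive permutation group is quasi-primitive if all its normal subgroups $\neq 1$ are transitive. *)

(* Defs.v *)
From mathcomp Require Import all_boot all_fingroup all_solvable.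

Set Implicit Arguments.
Unset Strict Implicit.
Unset Printing Implicit Defensive.

Local Open Scope group_scope.

Definition minimally_transitive (T : finType) (G : {group {perm T}}) : Prop :=
  [transitive G, on [set: T] | 'P] /\
  forall H : {group {perm T}},
    H \proper G -> ~ [transitive H, on [set: T] | 'P].

(* 'C_G(S | to) is the pointwise stabiliser of S in G, i.e. the kernel of the
   action of G on S. *)
Definition acts_minimally_transitively (aT : finGroupType) (rT : finType)
    (to : {action aT &-> rT}) (G : {group aT}) (S : {set rT}) : Prop :=
  [transitive G, on S | to] /\
  forall H : {group aT},
    'C_G(S | to) \subset H -> H \proper G -> ~ [transitive H, on S | to].

Definition quasi_primitive (T : finType) (G : {group {perm T}}) : Prop :=
  [transitive G, on [set: T] | 'P] /\
  forall N : {group {perm T}},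
    N <| G -> N :!=: 1 -> [transitive N, on [set: T] | 'P].

Definition orbit_set (T : finType) (H : {group {perm T}}) : {set {set T}} :=
  orbit 'P H @: [set: T].

(* Main.v *)
Require Import Defs.
From mathcomp Require Import all_boot all_fingroup all_solvable.

Set Implicit Arguments.
Unset Strict Implicit.
Unset Printing Implicit Defensive.

Local Open Scope group_scope.

(** Both clauses use minimality in the form: a transitive subgroup of [G] is
    [G] itself.  If [G] is quasi-primitive, a nontrivial normal subgroup is
    transitive, hence equal to [G]; and [G] moves points, so it is simple.  For the second clause,
    [G] permutes the orbits of [H] because [H] is normal, and transitively
    because [G] is transitive on points.  Since [H] fixes each of its orbits as
    a set, it lies in the kernel of this action, so any subgroup [M] containing
    the kernel contains [H].  If [M] is transitive on the [H]-orbits, then it is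
    transitive on points ([trans_of_trans_orbit_set]): [M] moves the orbit of one
    point onto that of another, and [H], being inside [M], corrects the
    position within the orbit.  Hence [M] is not proper in [G]. *)

Lemma setact_orbit_norm (T : finType) (H : {group {perm T}}) (g : {perm T}) x :
  g \in 'N(H) -> ('P^*)%act (orbit 'P H x) g = orbit 'P H (g x).
Proof.
move=> nHg; apply/setP=> y; rewrite -(actKV 'P g y).
rewrite (mem_imset _ _ (act_inj 'P g)) -(orbit_conjsg 'P H g x) (normP nHg).
by rewrite /= apermE.
Qed.

Lemma trans_orbit_set (T : finType) (G H : {group {perm T}}) :
  G \subset 'N(H) -> [transitive G, on [set: T] | 'P] ->
  [transitive G, on orbit_set H | 'P^*].
Proof.
move=> nHG trG; have /imsetP[x _ defT] := trG.
apply/imsetP; exists (orbit 'P H x); first exact: imset_f (in_setT x).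
rewrite /orbit_set defT; apply/setP=> B; apply/imsetP/imsetP=> [[y]|[g Gg ->]].
  case/imsetP=> g Gg -> ->; exists g => //.
  by rewrite setact_orbit_norm ?(subsetP nHG) ?apermE.
exists (g x); first exact: mem_orbit.
by rewrite setact_orbit_norm ?(subsetP nHG).
Qed.

(** If [m] in [M] carries the [H]-orbit of [x] onto that
    of [y], then [y] is the image under [m] of a point [h x] with [h] in [H], and
    the product of [h] and [m] lies in [M] as soon as [H] does. *)
Lemma trans_of_trans_orbit_set (T : finType) (M H : {group {perm T}}) :
  H \subset M -> [transitive M, on orbit_set H | 'P^*] ->
  [transitive M, on [set: T] | 'P].
Proof.
move=> sHM trM; have /imsetP[_ /imsetP[x _ ->] _] := trM.
apply/imsetP; exists x => //; apply/esym/eqP; rewrite -subTset.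
apply/subsetP=> y _.
have orbS z : orbit 'P H z \in orbit_set H by exact: imset_f.
have [m Mm defHy] := atransP2 trM (orbS x) (orbS y).
have: y \in orbit 'P H y by exact: orbit_refl.
rewrite defHy => /imsetP[_ /imsetP[h Hh ->] ->].
by rewrite -actM mem_orbit // groupM // (subsetP sHM).
Qed.

Lemma sub_astab_orbit_set (T : finType) (H : {group {perm T}}) :
  H \subset 'C(orbit_set H | 'P^*).
Proof.
apply/subsetP=> h Hh; apply/astabP=> _ /imsetP[x _ ->].
by rewrite setact_orbit_norm ?(subsetP (normG H)) // -apermE (orbit_act 'P).
Qed.

Lemma minimally_transitive_eq (T : finType) (G H : {group {perm T}}) :
  minimally_transitive G -> H \subset G ->
  [transitive H, on [set: T] | 'P] -> H :=: G.
Proof.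
case=> _ minG sHG trH; apply/eqP; rewrite eqEproper sHG /=.
by apply/negP=> /minG; apply.
Qed.

(* In the one-point case G is trivial, and [simple] excludes the trivial group;
   hence the bound on #|T| in the first clause. *)
Theorem theorem2p4 (T : finType) (G : {group {perm T}})
    (minG : minimally_transitive G) :
  (quasi_primitive G -> 1 < #|T| -> simple G) /\
  (~ quasi_primitive G ->
     forall H : {group {perm T}}, H <| G -> H \proper G ->
       acts_minimally_transitively 'P^* G (orbit_set H)).
Proof.
have [trG _] := minG; split=> [[_ qpG] T_gt1 | _ H nsHG _].
  apply/simpleP; split=> [|N nsN].
    apply/eqP=> G1.
    (* The orbits of the trivial group are single points. *)
    case/imsetP: trG T_gt1 => x _ /(congr1 (fun A : {set T} => #|A|)).
    by rewrite G1 cardsT => ->; rewrite /orbit imset_set1 cards1.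
  have [-> | ntN] := eqVneq (N : {set _}) 1; [by left | right].
  exact: minimally_transitive_eq minG (normal_sub nsN) (qpG N nsN ntN).
have [sHG nHG] := andP nsHG; split; first exact: trans_orbit_set.
move=> M sKM ltMG trM.
have sHM : H \subset M.
  by apply: subset_trans sKM; rewrite subsetI sHG sub_astab_orbit_set.
by have [_ /(_ M ltMG)] := minG; apply; apply: trans_of_trans_orbit_set trM.
Qed.
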